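(* For every integer $n\ge 2$, $$\mathrm{SgnBAltrun}_{n,-,a}(p,q)=(1-pq)\,\mathrm{SgnBAltrun}_{n-2,-,a}(p,q),\qquad \mathrm{SgnBAltrun}_{n,-,d}(p,q)=(1-pq)\,\mathrm{SgnBAltrun}_{n-2,-,d}(p,q),$$ and consequently $$\mathrm{SgnBAltrun}_{n,-,a}(p,q)=\begin{cases}(1-q)(1-pq)^{k-1}& n=2k,\\ (1-pq)^k & n=2k+1,\end{cases}\qquad \mathrm{SgnBAltrun}_{n,-,d}(p,q)=\begin{cases}(1-p)(1-pq)^{k-1}& n=2k,\\ -(1-pq)^k & n=2k+1,\end{cases}$$ $$\mathrm{SgnBAltrun}_{n}(p,q)=\begin{cases}(2-p-q)(1-pq)^{k-1}& n=2k,\\ 0 & n \text{ odd}.\end{cases}$$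
   Context: $\mathfrak{B}_n$ is the group of signed permutations, written in window notation $\pi=\pi_1\cdots\pi_n$ with $\pi_i\in\{\pm1,\dots,\pm n\}$ and $\{|\pi_1|,\dots,|\pi_n|\}=[n]$. Its length is $\mathrm{inv}_B(\pi)=|\{1\le i<j\le n:\pi_i>\pi_j\}|+|\{1\le i<j\le n:-\pi_i>\pi_j\}|+|\{i:\pi_i<0\}|$ (comparisons in the usual order on $\mathbb{Z}$). Set $\pi_0=0$. Let $\mathrm{pk}_B(\pi)$ be the number of $i\in\{1,\dots,n-1\}$ with $\pi_{i-1}<\pi_i>\pi_{i+1}$, and $\mathrm{val}_B(\pi)$ the number of $i\in\{1,\dots,n-1\}$ with $\pi_{i-1}>\pi_i<\pi_{i+1}$. Let $\mathfrak{B}_{n,-,a}=\{\pi\in\mathfrak{B}_n:\pi_{n-1}<\pi_n\}$ and $\mathfrak{B}_{n,-,d}=\{\pi\in\mathfrak{B}_n:\pi_{n-1}>\pi_n\}$. Define $\mathrm{SgnBAltrun}_{n,-,a}(p,q)=\sum_{\pi\in\mathfrak{B}_{n,-,a}}(-1)^{\mathrm{inv}_B(\pi)}p^{\mathrm{pk}_B(\pi)}q^{\mathrm{val}_B(\pi)}$, similarly $\mathrm{SgnBAltrun}_{n,-,d}$ over $\mathfrak{B}_{n,-,d}$, and $\mathrm{SgnBAltrun}_{n}$ over all of $\mathfrak{B}_n$.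
   Formalization: The two recurrences are stated for n ≥ 3 only: at n = 2 the sets B_{0,-,a} and B_{0,-,d} are undefined, and 1-q and 1-p are not multiples of 1-pq in Z[p,q]; the closed forms are stated for all n ≥ 2. *)

(* Defs.v *)
From HB Require Import structures.
From mathcomp Require Import all_boot all_order all_algebra.
From mathcomp Require Import mpoly.

Set Implicit Arguments.
Unset Strict Implicit.
Unset Printing Implicit Defensive.

Import Order.TTheory GRing.Theory Num.Theory.
Local Open Scope ring_scope.

(* The pair (b, k) encodes the letter k + 1 if b = false and -(k + 1) if
   b = true, so that bool * 'I_n is the alphabet {±1, ..., ±n}, and the second
   component of a letter x stands for |x|. *)
Definition letter_val (n : nat) (x : bool * 'I_n) : int :=
  (-1) ^+ x.1 * (x.2.+1)%:Z.

(* The window pi_1 ... pi_n, subject to {|pi_1|, ..., |pi_n|} = [n]. *)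
Record signed_perm (n : nat) := SignedPerm {
  window : {ffun 'I_n -> bool * 'I_n};
  _ : [set (window i).2 | i : 'I_n] == [set: 'I_n] }.

HB.instance Definition _ (n : nat) := [isSub for @window n].
HB.instance Definition _ (n : nat) := [Finite of signed_perm n by <:].

(* pi_i for 1 <= i <= n, and pi_0 = 0; the value 0 returned for i > n is never
   used. *)
Definition entry (n : nat) (pi : signed_perm n) (i : nat) : int :=
  nth 0 (0 :: [seq letter_val (window pi k) | k : 'I_n]) i.

(* Positions 1, ..., n are the nonzero elements of 'I_n.+1. *)
Definition inv_B (n : nat) (pi : signed_perm n) : nat :=
  (#|[set ij : 'I_n.+1 * 'I_n.+1 |
       (0 < ij.1 < ij.2)%N && (entry pi ij.1 > entry pi ij.2)%R]|
   + #|[set ij : 'I_n.+1 * 'I_n.+1 |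
       (0 < ij.1 < ij.2)%N && (- entry pi ij.1 > entry pi ij.2)%R]|
   + #|[set i : 'I_n.+1 | (0 < i)%N && (entry pi i < 0)%R]|)%N.

Definition pk_B (n : nat) (pi : signed_perm n) : nat :=
  #|[set i : 'I_n | [&& (0 < i)%N, entry pi i.-1 < entry pi i
                      & entry pi i > entry pi i.+1]]|.

Definition val_B (n : nat) (pi : signed_perm n) : nat :=
  #|[set i : 'I_n | [&& (0 < i)%N, entry pi i.-1 > entry pi i
                      & entry pi i < entry pi i.+1]]|.

(* B_a and B_d are meaningful for n >= 1 only, since pi_(n-1) does not exist
   for n = 0. *)
Definition B_a (n : nat) : {set signed_perm n} :=
  [set pi : signed_perm n | entry pi n.-1 < entry pi n].

Definition B_d (n : nat) : {set signed_perm n} :=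
  [set pi : signed_perm n | entry pi n.-1 > entry pi n].

Definition pvar : {mpoly int[2]} := 'X_0.
Definition qvar : {mpoly int[2]} := 'X_1.

Definition SgnBAltrun_on (n : nat) (A : {set signed_perm n}) : {mpoly int[2]} :=
  \sum_(pi in A) (-1) ^+ inv_B pi * pvar ^+ pk_B pi * qvar ^+ val_B pi.

Definition SgnBAltrun_a (n : nat) : {mpoly int[2]} := SgnBAltrun_on (B_a n).
Definition SgnBAltrun_d (n : nat) : {mpoly int[2]} := SgnBAltrun_on (B_d n).
Definition SgnBAltrun (n : nat) : {mpoly int[2]} :=
  SgnBAltrun_on [set: signed_perm n].

(* Main.v *)
(* Exchanging the values n-1 and n (and -(n-1) and -n) in a signed permutation
   reverses its sign. It alters only the comparison between two adjacent letters
   of the same sign and of absolute values n-1 and n. If such a pair is followed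
   by another letter, it lies with its neighbours on a single peak (or valley),
   whichever the order of the pair, so pk, val and the last comparison do not
   change. What is left are the signed permutations that end with such a pair:
   each is an element of B_(n-2) followed by one of the four words (n-1)n,
   n(n-1), -(n-1)-n, -n-(n-1), which gives the recursion. *)

Require Import Defs.
From HB Require Import structures.
From mathcomp Require Import all_boot all_order all_algebra.
From mathcomp Require Import mpoly.
From mathcomp Require Import perm zify ring.

Set Implicit Arguments.
Unset Strict Implicit.
Unset Printing Implicit Defensive.

Import Order.TTheory GRing.Theory Num.Theory.
Local Open Scope ring_scope.

(** * Letters and entries of a signed permutation *)

Lemma absz_letter n (x : bool * 'I_n) : `|letter_val x|%N = x.2.+1.
Proof. by rewrite /letter_val abszMsign. Qed.

Lemma letter_val_gt0 n (x : bool * 'I_n) : (0 < letter_val x) = ~~ x.1.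
Proof. by case: x => [[] k]; rewrite /letter_val /= ?expr1 ?expr0; lia. Qed.

Lemma window_inj n (pi : signed_perm n) :
  injective (fun i => (window pi i).2).
Proof.
have /eqP im := valP pi.
move=> i j.
suff inj : {in predT &, injective (fun i => (window pi i).2)} by exact: inj.
by apply/imset_injP; rewrite im cardsT.
Qed.

Lemma window_exist n (f : {ffun 'I_n -> bool * 'I_n}) :
  injective (fun i => (f i).2) -> exists pi : signed_perm n, window pi = f.
Proof.
move=> f_inj.
suff im : [set (f i).2 | i : 'I_n] == [set: 'I_n] by exists (SignedPerm im).
by rewrite eqEcard subsetT card_imset //= cardsT.
Qed.

Lemma entry0 n (pi : signed_perm n) : entry pi 0 = 0.
Proof. by []. Qed.

Lemma entryS n (pi : signed_perm n) (i : 'I_n) :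
  entry pi i.+1 = letter_val (window pi i).
Proof.
rewrite /entry /= (nth_map i) ?size_enum_ord //.
by rewrite nth_ord_enum.
Qed.

Variant position n : nat -> Prop :=
  Position (k : 'I_n) : position n k.+1.

Lemma positionP n i : (0 < i <= n)%N -> position n i.
Proof. by case: i => // i lt_in; exact: (Position (Ordinal lt_in)). Qed.

Lemma absz_entry_bounds n (pi : signed_perm n) i :
  (0 < i <= n)%N -> (0 < `|entry pi i| <= n)%N.
Proof. by case/positionP=> k; rewrite entryS absz_letter ltn_ord. Qed.

Lemma absz_entry_inj n (pi : signed_perm n) i j :
    (0 < i <= n)%N -> (0 < j <= n)%N ->
  `|entry pi i|%N = `|entry pi j|%N -> i = j.
Proof.
case/positionP=> k; case/positionP=> l.
by rewrite !entryS !absz_letter => -[/val_inj /(@window_inj _ pi) ->].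
Qed.

Lemma absz_entry_onto n (pi : signed_perm n) k :
  (0 < k <= n)%N -> exists2 i, (0 < i <= n)%N & `|entry pi i|%N = k.
Proof.
case/positionP=> l.
have /imsetP[i _ ->] : l \in [set (window pi i).2 | i : 'I_n].
  by rewrite (eqP (valP pi)) inE.
by exists i.+1; rewrite ?ltn_ord // entryS absz_letter.
Qed.

Lemma entry_adj_neq n (pi : signed_perm n) i :
  (i < n)%N -> entry pi i != entry pi i.+1.
Proof.
move=> lt_in; apply/eqP => eq_e.
case: i => [|i] in lt_in eq_e *.
  by have := @absz_entry_bounds n pi 1; rewrite -eq_e => /(_ lt_in).
suff : i.+1 = i.+2 by lia.
apply: (@absz_entry_inj n pi); [lia | lia | by rewrite eq_e].
Qed.

(** * The sign and the peak-valley weight as products over positions *)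

(* For letters x, y with |x| <> |y|, [x > y] + [-x > y] has the parity of
   [|x| > |y|]; hence the sign depends on inversions of absolute values. *)
Definition sign (n : nat) (e : nat -> int) : {mpoly int[2]} :=
  \prod_(1 <= j < n.+1)
    ((-1) ^+ (e j < 0)%R * \prod_(1 <= i < j) (-1) ^+ (`|e j| < `|e i|)%N).

Definition turn (x y z : int) : {mpoly int[2]} :=
  pvar ^+ ((x < y) && (z < y))%R * qvar ^+ ((y < x) && (y < z))%R.

Definition turns (n : nat) (e : nat -> int) : {mpoly int[2]} :=
  \prod_(1 <= i < n) turn (e i.-1) (e i) (e i.+1).

(** Turns the cardinals in the exponents into products of local factors, so that a change at a few
    positions touches only a few factors. *)
Lemma expr_card (R : comNzRingType) (x : R) (T : finType) (P Q : pred T) :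
  x ^+ #|[set i | P i && Q i]| = \prod_(i | P i) x ^+ Q i.
Proof.
rewrite -prodr_const big_mkcond [RHS]big_mkcond; apply: eq_bigr => i _.
by rewrite inE; case: (P i); case: (Q i).
Qed.

Lemma turnsE n (pi : signed_perm n) :
  pvar ^+ pk_B pi * qvar ^+ val_B pi = turns n (entry pi).
Proof.
rewrite /pk_B /val_B !expr_card -big_split /= /turns big_geq_mkord.
by apply: eq_big => // i.
Qed.

Lemma signE n (pi : signed_perm n) : (-1) ^+ inv_B pi = sign n (entry pi).
Proof.
rewrite /sign big_split /= /inv_B !exprD !expr_card -big_split /= mulrC.
congr (_ * _); first by rewrite big_geq_mkord; apply: eq_big.
rewrite [RHS]big_geq_mkord /=.
(* The inner range is widened to a fixed type, so that the two products can be exchanged and merged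
   into one over pairs i < j. *)
transitivity (\prod_(j < n.+1 | (0 < j)%N) \prod_(i < n.+1 | (0 < i < j)%N)
   ((-1) ^+ (`|entry pi j| < `|entry pi i|)%N : {mpoly int[2]})); last first.
  apply: eq_bigr => j j_gt0; rewrite big_geq_mkord /=.
  rewrite (big_ord_widen_cond n.+1 (fun i => (0 < i)%N)
    (fun i => (-1) ^+ (`|entry pi j| < `|entry pi i|)%N)) //.
  by rewrite ltnW.
rewrite (exchange_big_dep (fun i : 'I_n.+1 => (0 < i)%N)) /=; last first.
  by move=> i j _ /andP[].
rewrite pair_big_dep /=; apply: eq_big => [[i j]|[i j]] /=; first by lia.
case/andP=> i_gt0 lt_ij; rewrite -exprD -[LHS]signr_odd oddD !oddb.
have le_jn := ltn_ord j.
have neq : `|entry pi i|%N <> `|entry pi j|%N.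
  by move/absz_entry_inj => /(_ _ _); lia.
congr (_ ^+ nat_of_bool _); lia.
Qed.

(** * Exchange of the two largest absolute values, on integers *)

(** For letters of B_(m+2) with |x| <> |y|, this says that x and y have the same sign and absolute
    values m+1 and m+2 in some order. *)
Definition tied m (x y : int) :=
  [&& (m < `|x|)%N, (m < `|y|)%N & (0 < x) == (0 < y)].

Definition exch (m : nat) (x : int) : int :=
  if x == m.+1%:Z then m.+2%:Z else if x == m.+2%:Z then m.+1%:Z
  else if x == - m.+1%:Z then - m.+2%:Z else if x == - m.+2%:Z then - m.+1%:Z
  else x.

(** How a letter of absolute value m+1 or m+2 compares with a smaller one, or with one of the
    opposite sign, depends only on its own sign, which [exch] keeps. *)
Lemma exch_lt m (x y : int) :
    (`|x| <= m.+2)%N -> (`|y| <= m.+2)%N -> `|x|%N <> `|y|%N ->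
  ~~ tied m x y -> (exch m x < exch m y) = (x < y).
Proof.
rewrite /tied /exch; do !case: eqP => ?; lia.
Qed.

Lemma exch_tied m (x y : int) :
    (`|x| <= m.+2)%N -> (`|y| <= m.+2)%N -> `|x|%N <> `|y|%N ->
  tied m x y -> exch m x = y.
Proof.
rewrite /tied /exch; do !case: eqP => ?; lia.
Qed.

Lemma tiedC m x y : tied m x y = tied m y x.
Proof. by rewrite /tied; lia. Qed.

Lemma exch_id m (x : int) : (`|x| <= m)%N -> exch m x = x.
Proof.
rewrite /exch; do !case: eqP => ?; lia.
Qed.

Lemma exch_lt0 m (x : int) : (exch m x < 0) = (x < 0).
Proof. by rewrite /exch; do !case: eqP => ?; lia. Qed.

(** A positive pair exceeds both neighbours and yields one peak, at its larger letter; a negative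
    pair lies below both and yields one valley, at its smaller letter. The order within the pair
    only moves this turn. *)
Lemma turn_tied m (u x y v : int) :
    (`|u| <= m)%N -> (`|v| <= m)%N -> x != y -> tied m x y ->
  turn u x y * turn x y v = turn u y x * turn y x v.
Proof.
rewrite /tied /turn => u_le v_le x_y xy_tied.
have [x_gt0|x_le0] := ltP 0 x.
  have -> : u < x by lia.
  have -> : u < y by lia.
  have -> : v < x by lia.
  have -> : v < y by lia.
  have -> : x < u = false by lia.
  have -> : y < u = false by lia.
  have -> : x < v = false by lia.
  have -> : y < v = false by lia.
  rewrite /= !andbT !andbF.
  by case: ltgtP x_y => // _ _; rewrite !expr0 !expr1; ring.
have -> : u < x = false by lia.
have -> : u < y = false by lia.
have -> : v < x = false by lia.
have -> : v < y = false by lia.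
have -> : x < u by lia.
have -> : y < u by lia.
have -> : x < v by lia.
have -> : y < v by lia.
rewrite /= !andbT !andbF.
by case: ltgtP x_y => // _ _; rewrite !expr0 !expr1; ring.
Qed.

(** * The exchange as an involution of B_(m+2) *)

Definition penult m : 'I_m.+2 := Ordinal (leqnSn m.+1).

Definition exch_window m (pi : signed_perm m.+2) :=
  [ffun i => ((window pi i).1, tperm (penult m) ord_max (window pi i).2)].

Lemma exch_window_subproof m (pi : signed_perm m.+2) :
  [set (exch_window pi i).2 | i : 'I_m.+2] == [set: 'I_m.+2].
Proof.
rewrite eqEcard subsetT card_imset ?cardsT //= => i j.
by rewrite !ffunE /= => /perm_inj /(@window_inj _ pi).
Qed.

Definition exch_perm m (pi : signed_perm m.+2) :=
  SignedPerm (exch_window_subproof pi).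

Lemma exch_permK m : involutive (@exch_perm m).
Proof.
move=> pi; apply/val_inj/ffunP=> i /=.
by rewrite !ffunE /= tpermK; case: (window pi i).
Qed.

Lemma entry_exch m (pi : signed_perm m.+2) i :
  (i <= m.+2)%N -> entry (exch_perm pi) i = exch m (entry pi i).
Proof.
case: (posnP i) => [->|i_gt0] i_le.
  by rewrite !entry0 exch_id.
have /positionP[k] : (0 < i <= m.+2)%N by rewrite i_gt0.
rewrite !entryS /= ffunE /letter_val /exch.
case: (window pi k) => b l /=.
have := ltn_ord l.
case: tpermP => [->|->|/eqP + /eqP +];
  rewrite -?(inj_eq val_inj) /= => *; case: b; rewrite ?expr0 ?expr1;
  do !case: eqP => ?; lia.
Qed.

(** The two positions come in increasing order because [sign] ranges over pairs i < j. Position 0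
    counts among the small ones, its entry being 0. *)
Lemma top_positions m (pi : signed_perm m.+2) :
  exists ab : nat * nat,
    [/\ (0 < ab.1 < ab.2)%N, (ab.2 <= m.+2)%N, (m < `|entry pi ab.1|)%N,
        (m < `|entry pi ab.2|)%N
      & forall k, (k <= m.+2)%N -> k <> ab.1 -> k <> ab.2 ->
          (`|entry pi k| <= m)%N].
Proof.
have [|u u_n eu] := @absz_entry_onto _ pi m.+1; first by rewrite leqnSn.
have [|v v_n ev] := @absz_entry_onto _ pi m.+2; first by rewrite leqnn.
have other k : (k <= m.+2)%N -> k <> u -> k <> v -> (`|entry pi k| <= m)%N.
  move=> k_n k_u k_v; case: (posnP k) => [->|k_gt0]; first by [].
  have := @absz_entry_bounds _ pi k; rewrite k_gt0 k_n => /(_ isT).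
  have := @absz_entry_inj _ pi k u; have := @absz_entry_inj _ pi k v.
  by rewrite k_gt0 k_n u_n v_n eu ev; lia.
have u_v : u <> v by move=> uv; move: eu; rewrite uv ev; lia.
case: (ltngtP u v) => // uv; [exists (u, v) | exists (v, u)];
  by split=> /=; try lia; move=> k *; apply: other.
Qed.

(** The reflection t -> 2m+3-t swaps m+1 and m+2. *)
Lemma absz_exch m (x : int) : (`|x| <= m.+2)%N ->
  `|exch m x|%N = if (m < `|x|)%N then (2 * m + 3 - `|x|)%N else `|x|%N.
Proof. by rewrite /exch; case: ltnP => ?; do !case: eqP => ?; lia. Qed.

(** Signs of letters are kept, and among the comparisons of absolute values only that of the two
    largest is reversed: exactly one factor changes sign. *)
Lemma sign_exch m (pi : signed_perm m.+2) :
  sign m.+2 (entry (exch_perm pi)) = - sign m.+2 (entry pi).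
Proof.
have [[a b] /= [a_b b_n ea eb other]] := top_positions pi.
have large k : (k <= m.+2)%N -> (m < `|entry pi k|)%N = (k == a) || (k == b).
  move=> k_n; do 2![case: eqP => [->|?] //=].
  by apply/negbTE; rewrite -leqNgt; apply: other.
have flip i j : (0 < i < j)%N -> (j <= m.+2)%N ->
    (`|exch m (entry pi j)| < `|exch m (entry pi i)|)%N
  = (`|entry pi j| < `|entry pi i|)%N (+) ((i == a) && (j == b)).
  move=> i_j j_n.
  have i_bd : (0 < `|entry pi i| <= m.+2)%N by apply: absz_entry_bounds; lia.
  have j_bd : (0 < `|entry pi j| <= m.+2)%N by apply: absz_entry_bounds; lia.
  have ij_neq : `|entry pi i|%N <> `|entry pi j|%N.
    by move/absz_entry_inj; lia.
  rewrite !absz_exch; try lia.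
  have := large i; have := large j.
  by case: (ltnP m `|entry pi i|); case: (ltnP m `|entry pi j|);
    do !case: eqP => ?; lia.
(* Collected over i, the reversed comparison shows up only in the factor of the later position b. *)
have factor j : (0 < j <= m.+2)%N ->
    \prod_(1 <= i < j) ((-1) ^+ (`|entry (exch_perm pi) j|
                          < `|entry (exch_perm pi) i|)%N : {mpoly int[2]})
  = (-1) ^+ (j == b) *
    \prod_(1 <= i < j) (-1) ^+ (`|entry pi j| < `|entry pi i|)%N.
  move=> j_n.
  transitivity (\prod_(1 <= i < j) ((-1) ^+ ((i == a) && (j == b)) *
      (-1) ^+ (`|entry pi j| < `|entry pi i|)%N : {mpoly int[2]})).
    apply: eq_big_nat => i i_j.
    by rewrite !entry_exch ?flip; [rewrite signr_addb mulrC | lia..].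
  rewrite big_split /=; congr (_ * _).
  case: eqP => [->|_]; last by apply: big1 => i _; rewrite andbF.
  rewrite (bigD1_seq a) ?mem_index_iota ?iota_uniq //= eqxx.
  by rewrite big1 ?mulr1 // => i /negPf->.
rewrite /sign.
transitivity (\prod_(1 <= j < m.+3) ((-1) ^+ (j == b) *
    ((-1) ^+ (entry pi j < 0)%R *
     \prod_(1 <= i < j) (-1) ^+ (`|entry pi j| < `|entry pi i|)%N)
    : {mpoly int[2]})).
  apply: eq_big_nat => j j_n.
  rewrite factor // entry_exch ?exch_lt0; last by lia.
  by rewrite mulrCA.
rewrite big_split /= (bigD1_seq b) ?mem_index_iota ?iota_uniq //=; last lia.
rewrite eqxx expr1 big1 ?mulr1 ?mulN1r // => i /negPf->.
by [].
Qed.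

Lemma exch_entry_lt m (pi : signed_perm m.+2) i :
    (i < m.+2)%N -> ~~ tied m (entry pi i) (entry pi i.+1) ->
    ((exch m (entry pi i) < exch m (entry pi i.+1))
       = (entry pi i < entry pi i.+1)) *
    ((exch m (entry pi i.+1) < exch m (entry pi i))
       = (entry pi i.+1 < entry pi i)).
Proof.
move=> i_n not_tied.
have := @absz_entry_inj _ pi i i.+1; have := @absz_entry_bounds _ pi i.
have := @absz_entry_bounds _ pi i.+1; have := entry_adj_neq pi i_n.
case: (posnP i) not_tied => [->|i_gt0] not_tied; rewrite ?entry0 => *.
  by split; apply: exch_lt; rewrite // 1?tiedC //; lia.
by split; apply: exch_lt; rewrite // 1?tiedC //; lia.
Qed.

(** Only two letters have absolute value above m, and a tied pair uses up both. *)
Lemma tied_others m (pi : signed_perm m.+2) i k :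
    (i < m.+2)%N -> tied m (entry pi i) (entry pi i.+1) ->
    (k <= m.+2)%N -> k <> i -> k <> i.+1 ->
  (`|entry pi k| <= m)%N.
Proof.
move=> i_n i_tied k_n k1 k2.
have [[a b] /= [_ b_n ea eb small]] := top_positions pi.
move: i_tied; rewrite /tied => i_tied.
have := small i; have := small i.+1; have := small k; lia.
Qed.

(** Without adjacent tied letters every relevant comparison is kept; an adjacent tied pair that is
    not last has a neighbour on each side, and [turn_tied] applies. *)
Lemma turns_exch m (pi : signed_perm m.+2) :
    ~~ tied m (entry pi m.+1) (entry pi m.+2) ->
  turns m.+2 (entry (exch_perm pi)) = turns m.+2 (entry pi).
Proof.
move=> last_not_tied.
have turn_eq i : (0 < i < m.+2)%N ->
    ~~ tied m (entry pi i.-1) (entry pi i) ->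
    ~~ tied m (entry pi i) (entry pi i.+1) ->
    turn (entry (exch_perm pi) i.-1) (entry (exch_perm pi) i)
         (entry (exch_perm pi) i.+1)
  = turn (entry pi i.-1) (entry pi i) (entry pi i.+1).
  case: i => // i i_n t1 t2; rewrite /turn !entry_exch; try lia.
  by rewrite !exch_entry_lt //=; lia.
(* The index stops at m: the remaining pair, at m+1 and m+2, is untied by hypothesis. *)
case: (boolP [exists i : 'I_m.+1, tied m (entry pi i) (entry pi i.+1)]);
  last first.
  rewrite negb_exists => /forallP no_tie.
  have no_tie' i : (i <= m.+1)%N -> ~~ tied m (entry pi i) (entry pi i.+1).
    rewrite leq_eqVlt => /predU1P[-> //|i_m].
    exact: (no_tie (Ordinal i_m)).
  apply: eq_big_nat => -[//|i] i_n; apply: turn_eq => //; apply: no_tie'; lia.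
case/existsP=> -[[|i] /= i_m] i_tied.
  by move: i_tied; rewrite /tied entry0.
have i_neq := @entry_adj_neq _ pi i.+1 (leqW i_m).
have abs_le k : (k <= m.+2)%N -> (`|entry pi k| <= m.+2)%N.
  move=> k_n; case: (posnP k) => [->//|k_gt0].
  by have := @absz_entry_bounds _ pi k; lia.
have abs_neq : `|entry pi i.+1|%N <> `|entry pi i.+2|%N.
  by move/absz_entry_inj; lia.
have other := tied_others (leqW i_m : (i.+1 < m.+2)%N) i_tied.
have swap1 : exch m (entry pi i.+1) = entry pi i.+2.
  by apply: exch_tied => //; apply: abs_le; lia.
have swap2 : exch m (entry pi i.+2) = entry pi i.+1.
  apply: exch_tied; rewrite 1?tiedC //; try (by apply: abs_le; lia).
  exact/nesym.
rewrite /turns.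
have in1 : i.+1 \in index_iota 1 m.+2 by rewrite mem_index_iota; lia.
have in2 : i.+2 \in index_iota 1 m.+2 by rewrite mem_index_iota; lia.
(* The exchange can affect only the two turns centred at the tied pair, so these are split off. *)
have split_turns (e : nat -> int) :
  \prod_(1 <= j < m.+2) turn (e j.-1) (e j) (e j.+1)
  = turn (e i) (e i.+1) (e i.+2) * turn (e i.+1) (e i.+2) (e i.+3) *
    \prod_(1 <= j < m.+2 | (j != i.+1) && (j != i.+2))
       turn (e j.-1) (e j) (e j.+1).
  rewrite (bigD1_seq i.+1) ?iota_uniq //= -mulrA; congr (_ * _).
  rewrite -big_filter (bigD1_seq i.+2) ?filter_uniq ?iota_uniq //; last first.
    by rewrite mem_filter in2 andbT; lia.
  by rewrite big_filter_cond.
rewrite !split_turns; congr (_ * _).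
  rewrite !entry_exch ?swap1 ?swap2 ?exch_id; try lia;
    try (by apply: other; lia).
  by symmetry; apply: (turn_tied (m := m)) => //; apply: other; lia.
(* Every other turn compares no two letters of the tied pair with each other, so its comparisons are
   kept. *)
rewrite big_nat_cond [RHS]big_nat_cond.
apply: eq_bigr => j /and3P[j_n /eqP j1 /eqP j2].
case: j j1 j2 j_n => // j j1 j2 j_n; apply: turn_eq => //.
  have := other j; have := other j.+1; rewrite /tied; lia.
have := other j.+1; have := other j.+2; rewrite /tied; lia.
Qed.

(** * Cancellation of the signed permutations whose last two letters are untied *)

Definition term n (pi : signed_perm n) : {mpoly int[2]} :=
  sign n (entry pi) * turns n (entry pi).

Definition last_tied m (pi : signed_perm m.+2) :=
  tied m (entry pi m.+1) (entry pi m.+2).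

Lemma last_tied_exch m (pi : signed_perm m.+2) :
  last_tied (exch_perm pi) = last_tied pi.
Proof.
rewrite /last_tied !entry_exch // /tied.
have := @absz_entry_bounds _ pi m.+1; have := @absz_entry_bounds _ pi m.+2.
rewrite !leqnn !leqnSn => /(_ isT) ? /(_ isT) ?.
by rewrite /exch; do !case: eqP => ?; lia.
Qed.

Lemma mpoly_eq_opp0 (x : {mpoly int[2]}) : x = - x -> x = 0.
Proof.
move=> x_opp; apply/mpolyP=> k; rewrite mcoeff0.
have := congr1 (mcoeff k) x_opp; rewrite mcoeffN; lia.
Qed.

(** A sign-reversing involution: [exch_perm] permutes the index set and negates each term, so the
    sum equals its own negative. *)
Lemma sum_untied m (P : pred (signed_perm m.+2)) :
    (forall pi, ~~ last_tied pi -> P (exch_perm pi) = P pi) ->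
  \sum_(pi | P pi && ~~ last_tied pi) term pi = 0.
Proof.
move=> P_exch; apply: mpoly_eq_opp0.
rewrite {1}(reindex_inj (inv_inj (@exch_permK m))) /= -sumrN.
apply: eq_big => [pi | pi /andP[_ pi_untied]].
  by rewrite last_tied_exch; case: (boolP (last_tied pi)) => [|/P_exch->];
    rewrite ?andbF.
rewrite last_tied_exch in pi_untied.
by rewrite /term sign_exch turns_exch // mulNr.
Qed.

(** * Appending a tied pair to an element of B_m *)

Definition low_pos m : 'I_m -> 'I_m.+2 := widen_ord (leqW (leqnSn m)).

(** The bit [bc.1] is the common sign of the two new letters (true for negative); [bc.2] tells
    whether the larger absolute value m+2 comes first. *)
Definition ext_window m (s : signed_perm m) (bc : bool * bool) :
    {ffun 'I_m.+2 -> bool * 'I_m.+2} :=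
  [ffun i : 'I_m.+2 =>
    if insub (val i) is Some j return bool * 'I_m.+2
    then ((window s j).1, low_pos (window s j).2)
    else (bc.1, if (i == ord_max) == bc.2 then penult m else ord_max)].

Lemma ext_window_low m (s : signed_perm m) bc (j : 'I_m) :
  ext_window s bc (low_pos j) = ((window s j).1, low_pos (window s j).2).
Proof. by rewrite ffunE /= -[X in insub X]/(val j) valK. Qed.

Lemma ext_window_penult m (s : signed_perm m) bc :
  ext_window s bc (penult m) =
    (bc.1, if bc.2 then ord_max else penult m).
Proof.
rewrite ffunE insubF /= ?ltnn //.
by rewrite -(inj_eq val_inj) /= ltn_eqF //; case: bc.2.
Qed.

Lemma ext_window_max m (s : signed_perm m) bc :
  ext_window s bc ord_max =
    (bc.1, if bc.2 then penult m else ord_max).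
Proof. by rewrite ffunE insubF /= ?ltnNge ?leqnSn // eqxx; case: bc.2. Qed.

Variant ext_position m : 'I_m.+2 -> Prop :=
  | ExtLow (j : 'I_m) : ext_position (low_pos j)
  | ExtPenult : ext_position (penult m)
  | ExtMax : ext_position ord_max.

Lemma ext_positionP m (i : 'I_m.+2) : ext_position i.
Proof.
case: (ltnP i m) => [i_m|m_i].
  by rewrite (_ : i = low_pos (Ordinal i_m));
     [constructor | apply: val_inj].
have [i_m|i_m] := eqVneq (i : nat) m.
  by rewrite (_ : i = penult m); [constructor | apply: val_inj].
rewrite (_ : i = ord_max); first by constructor.
by apply: val_inj => /=; have := ltn_ord i; lia.
Qed.

Lemma ext_window_inj m (s : signed_perm m) bc :
  injective (fun i => (ext_window s bc i).2).
Proof.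
move=> i j; case: (ext_positionP i) => [k||]; case: (ext_positionP j) => [l||];
  rewrite ?ext_window_penult ?ext_window_max ?ext_window_low //=
    => /(congr1 val) /=.
- by move/val_inj/(@window_inj _ s)->.
all: case: bc => _ [] /=; try (have := ltn_ord (window s k).2);
  try (have := ltn_ord (window s l).2); lia.
Qed.

Lemma ext_subproof m (s : signed_perm m) bc :
  [set (ext_window s bc i).2 | i : 'I_m.+2] == [set: 'I_m.+2].
Proof.
by rewrite eqEcard subsetT card_imset ?cardsT //=; apply: ext_window_inj.
Qed.

Definition ext m (s : signed_perm m) bc := SignedPerm (ext_subproof s bc).

Lemma entry_ext_low m (s : signed_perm m) bc i :
  (i <= m)%N -> entry (ext s bc) i = entry s i.
Proof.
case: (posnP i) => [->|i_gt0] i_m //.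
have /positionP[k] : (0 < i <= m)%N by rewrite i_gt0.
by rewrite -[k.+1]/((low_pos k).+1) entryS
  ext_window_low entryS.
Qed.

Lemma entry_ext_penult m (s : signed_perm m) bc :
  entry (ext s bc) m.+1 = (-1) ^+ bc.1 * (if bc.2 then m.+2 else m.+1)%:Z.
Proof.
rewrite -[m.+1]/((penult m).+1) entryS ext_window_penult /letter_val /=.
by case: bc.2.
Qed.

Lemma entry_ext_max m (s : signed_perm m) bc :
  entry (ext s bc) m.+2 = (-1) ^+ bc.1 * (if bc.2 then m.+1 else m.+2)%:Z.
Proof.
rewrite -[m.+2]/((@ord_max m.+1).+1) entryS ext_window_max /letter_val /=.
by case: bc.2.
Qed.

Lemma ext_inj m : injective (fun sbc : signed_perm m * (bool * bool) =>
  ext sbc.1 sbc.2).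
Proof.
move=> [s [b c]] [s' [b' c']] /= eq_ext.
have eq_w i : ext_window s (b, c) i = ext_window s' (b', c') i.
  by rewrite -[LHS]/(window (ext _ _) i) eq_ext.
have eq_max := eq_w ord_max; rewrite !ext_window_max /= in eq_max.
have [eq_b eq_c] : b = b' /\ c = c'.
  case: eq_max => -> /(congr1 val) /= eq_c; split=> //.
  by case: c c' eq_c {eq_ext eq_w} => [] [] /=; lia.
rewrite eq_b eq_c; congr (_, _); apply/val_inj/ffunP=> j /=.
have := eq_w (low_pos j).
rewrite !ext_window_low => -[e1 /val_inj e2].
by rewrite (surjective_pairing (window s j)) e1 e2 -surjective_pairing.
Qed.

Lemma last_tied_ext m (s : signed_perm m) bc : last_tied (ext s bc).
Proof.
rewrite /last_tied /tied entry_ext_penult entry_ext_max.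
by case: bc => [[] []]; rewrite ?expr0 ?expr1 /=; lia.
Qed.

(** The last two letters take both absolute values above m, so the first m letters form a window of
    B_m. *)
Lemma last_tied_is_ext m (pi : signed_perm m.+2) :
  last_tied pi -> exists sbc, pi = ext sbc.1 sbc.2.
Proof.
move=> pi_tied.
have low j : ((window pi (low_pos j)).2 < m)%N.
  have := tied_others (ltnSn m.+1) pi_tied (k := j.+1).
  rewrite -[j.+1]/((low_pos j).+1) entryS absz_letter /=.
  by apply; have := ltn_ord j; lia.
pose f := [ffun j : 'I_m => ((window pi (low_pos j)).1,
                             Ordinal (low j))].
have [|s s_f] := @window_exist m f.
  move=> i j; rewrite !ffunE /= => -[/val_inj/(@window_inj _ pi)].
  by move/(congr1 val) => /= /val_inj.
(* The larger absolute value comes first exactly when the last letter has absolute value m+1. *)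
exists (s, ((window pi ord_max).1, (window pi ord_max).2 == penult m)).
apply/val_inj/ffunP=> i /=.
move: pi_tied; rewrite /last_tied /tied.
rewrite -[m.+2]/((@ord_max m.+1).+1) -[m.+1]/((penult m).+1).
rewrite !entryS !absz_letter.
have := @window_inj _ pi (penult m) ord_max.
case: (ext_positionP i) => [j||].
- by rewrite ext_window_low s_f ffunE /= => _ _;
    case: (window pi _) (low j) => b k /= k_m; congr (_, _); apply: val_inj.
- rewrite ext_window_penult /= !letter_val_gt0.
  case: (window pi (penult m)) (window pi ord_max) => [b k] [b' k'] /= neq.
  case/and3P=> m_k m_k' /eqP/negb_inj->; congr (_, _).
  have k_k' : val k <> val k'.
    by move/val_inj/neq/(congr1 val) => /=; lia.
  apply/val_inj; have := ltn_ord k; have := ltn_ord k'.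
  by move: k_k'; case: eqVneq => [->|]; rewrite -?val_eqE /=; lia.
rewrite ext_window_max.
case: (window pi ord_max) => [b' k'] /= _ /and3P[_ m_k' _]; congr (_, _).
apply/val_inj; have := ltn_ord k'.
by case: eqVneq => [->|]; rewrite -?val_eqE /=; lia.
Qed.

(** The new letters exceed all earlier ones in absolute value, so they add no inversion with those;
    their two equal sign factors cancel, and only their mutual order is left. *)
Lemma sign_ext m (s : signed_perm m) (b c : bool) :
  sign m.+2 (entry (ext s (b, c))) = (-1) ^+ c * sign m (entry s).
Proof.
have absE i : (0 < i <= m)%N -> (`|entry s i| < m.+1)%N.
  by move/(@absz_entry_bounds _ s); lia.
rewrite /sign (big_nat_recr m.+2) // !(big_nat_recr m.+1) //.
have low_prod z : (m < `|z|)%N ->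
  \prod_(1 <= i < m.+1) (-1) ^+ (`|z| < `|entry (ext s (b, c)) i|)%N
    = 1 :> {mpoly int[2]}.
  move=> z_gt; rewrite big_nat_cond big1 // => i /andP[i_m _].
  rewrite entry_ext_low; last by lia.
  suff -> : (`|z| < `|entry s i|)%N = false by [].
  by have := absE i; lia.
rewrite !low_prod ?entry_ext_penult ?entry_ext_max ?abszMsign ?absz_nat;
  [|by case: (c)..].
rewrite !mulr1 /= mul1r -mulrA mulrC; congr (_ * _).
  by case: b c {low_prod} => [] []; rewrite ?expr0 ?expr1 ?ltnSn 1?ltnNge
    ?leqnSn /=; ring.
apply: eq_big_nat => j j_m; rewrite entry_ext_low; last by lia.
congr (_ * _); apply: eq_big_nat => i i_j.
by rewrite !entry_ext_low //; lia.
Qed.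

(** The turn at m sees the first new letter only through its sign, so c may be set to false there.
    The turn at m+1 is a peak or a valley exactly when the larger absolute value comes first. *)
Lemma turns_ext m (s : signed_perm m) (b c : bool) :
  turns m.+2 (entry (ext s (b, c)))
  = turns m.+1 (entry (ext s (b, false)))
    * (pvar ^+ (~~ b && c) * qvar ^+ (b && c)).
Proof.
rewrite /turns big_nat_recr //=; congr (_ * _).
  apply: eq_big_nat => i /andP[i_gt0 i_m].
  have [i_lt|m_le] := ltnP i m; first by rewrite !entry_ext_low //; lia.
  have {m_le i_m i_gt0} [-> m_gt0] : i = m /\ (0 < m)%N by lia.
  rewrite !(@entry_ext_low m s _ m) //.
  rewrite !(@entry_ext_low m s _ m.-1) ?leq_pred //.
  rewrite !entry_ext_penult /turn /=.
  have := absz_entry_bounds s (i := m); rewrite leqnn m_gt0 => /(_ isT) bd.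
  by congr (_ ^+ nat_of_bool _ * _ ^+ nat_of_bool _); case: b c => [] [] /=;
    rewrite ?expr0 ?expr1; lia.
rewrite entry_ext_low // entry_ext_penult entry_ext_max /turn /=.
have bd : (`|entry s m| <= m)%N.
  case: (posnP m) => [m0|m_gt0].
    by rewrite [X in entry s X]m0.
  have := absz_entry_bounds s (i := m); rewrite leqnn m_gt0.
  by case/(_ isT)/andP.
by congr (_ ^+ nat_of_bool _ * _ ^+ nat_of_bool _); case: b c => [] [] /=;
  rewrite ?expr0 ?expr1; lia.
Qed.

(** * The last comparison, and reduction of the sums to tied endings *)

Definition last_asc n (pi : signed_perm n) := entry pi n.-1 < entry pi n.

Lemma last_asc_ext m (s : signed_perm m) (b c : bool) :
  last_asc (ext s (b, c)) = (b == c).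
Proof.
rewrite /last_asc /= entry_ext_penult entry_ext_max.
by case: b c => [] [] /=; rewrite ?expr0 ?expr1; lia.
Qed.

Lemma last_asc_exch m (pi : signed_perm m.+2) :
  ~~ last_tied pi -> last_asc (exch_perm pi) = last_asc pi.
Proof.
move=> pi_untied; rewrite /last_asc /= !entry_exch //.
by rewrite exch_entry_lt.
Qed.

Lemma SgnBAltrun_onE n (A : {set signed_perm n}) :
  SgnBAltrun_on A = \sum_(pi in A) term pi.
Proof.
by apply: eq_bigr => pi _; rewrite /term -signE -turnsE mulrA.
Qed.

Lemma SgnBAltrun_aE n :
  SgnBAltrun_a n = \sum_(pi : signed_perm n | last_asc pi) term pi.
Proof.
by rewrite /SgnBAltrun_a SgnBAltrun_onE; apply: eq_bigl => pi; rewrite inE.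
Qed.

(** Adjacent entries differ, so the last step descends when it does not ascend. For n = 0 both sides
    of the comparison are the same entry. *)
Lemma SgnBAltrun_dE n : (0 < n)%N ->
  SgnBAltrun_d n = \sum_(pi : signed_perm n | ~~ last_asc pi) term pi.
Proof.
case: n => // n _; rewrite /SgnBAltrun_d SgnBAltrun_onE; apply: eq_bigl => pi.
rewrite inE /last_asc -leNgt le_eqVlt eq_sym.
by rewrite (negbTE (entry_adj_neq pi (ltnSn n))).
Qed.

Lemma SgnBAltrun_split n : (0 < n)%N ->
  SgnBAltrun n = SgnBAltrun_a n + SgnBAltrun_d n.
Proof.
move=> n_gt0; rewrite SgnBAltrun_aE SgnBAltrun_dE // /SgnBAltrun SgnBAltrun_onE.
by rewrite (bigID (@last_asc n)) /=; congr (_ + _); apply: eq_bigl => pi;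
  rewrite inE.
Qed.

(** The untied part cancels, and [ext] parametrizes the tied part bijectively. *)
Lemma sum_ext m (P : pred (signed_perm m.+2)) :
    (forall pi, ~~ last_tied pi -> P (exch_perm pi) = P pi) ->
  \sum_(pi | P pi) term pi
  = \sum_s \sum_b \sum_c
      if P (ext s (b, c)) then term (ext s (b, c)) else 0.
Proof.
move=> P_exch.
rewrite (bigID (@last_tied m)) /= sum_untied // addr0.
pose h (sbc : signed_perm m * (bool * bool)) := ext sbc.1 sbc.2.
transitivity (\sum_(pi in h @: [set sbc | P (h sbc)]) term pi).
  apply: eq_bigl => pi; apply/andP/imsetP.
  - case=> [P_pi /last_tied_is_ext[sbc pi_E]].
    by exists sbc => //; rewrite inE /h -pi_E.
  - by case=> sbc; rewrite inE => P_sbc ->; split=> //; apply: last_tied_ext.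
rewrite big_imset /=; last by move=> x y _ _; apply: ext_inj.
under [RHS]eq_bigr => s _ do rewrite pair_bigA.
rewrite pair_bigA big_mkcond.
by apply: eq_bigr => -[s [b c]] _; rewrite inE.
Qed.

(** * The recursion *)

(* [turns] with upper bound m.+1 sees only the first letter that [ext] appends,
   and only the position of that letter above ([b = false]) or below all others
   matters. *)
Definition append_sum m (b : bool) : {mpoly int[2]} :=
  \sum_(s : signed_perm m)
    sign m (entry s) * turns m.+1 (entry (ext s (b, false))).

(** With n = m+2, the ascending endings are (n-1)n, of weight 1, and -n-(n-1), of weight -q: one
    inversion and one valley. *)
Lemma SgnBAltrun_a_append m :
  SgnBAltrun_a m.+2 = append_sum m false - qvar * append_sum m true.
Proof.
rewrite SgnBAltrun_aE sum_ext; last exact: last_asc_exch.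
rewrite mulr_sumr -sumrB; apply: eq_bigr => s _.
rewrite !big_bool /= !last_asc_ext /= /term !sign_ext !turns_ext /=.
by rewrite !expr0 !expr1; ring.
Qed.

(** The descending endings are -(n-1)-n, of weight 1, and n(n-1), of weight -p. *)
Lemma SgnBAltrun_d_append m :
  SgnBAltrun_d m.+2 = append_sum m true - pvar * append_sum m false.
Proof.
rewrite SgnBAltrun_dE // sum_ext; last by move=> pi /last_asc_exch->.
rewrite mulr_sumr -sumrB; apply: eq_bigr => s _.
rewrite !big_bool /= !last_asc_ext /= /term !sign_ext !turns_ext /=.
by rewrite !expr0 !expr1; ring.
Qed.

(** A new lowest letter makes a peak of a final ascent, a new highest letter a valley of a final
    descent; otherwise no turn arises. *)
Lemma turns_append m (s : signed_perm m.+1) b :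
  turns m.+2 (entry (ext s (b, false)))
  = turns m.+1 (entry s) *
    (if last_asc s then pvar ^+ b else qvar ^+ ~~ b).
Proof.
rewrite /turns big_nat_recr //=; congr (_ * _).
  by apply: eq_big_nat => i i_m; rewrite !entry_ext_low //; lia.
rewrite (@entry_ext_low m.+1 s _ m) // (@entry_ext_low m.+1 s _ m.+1) //.
rewrite entry_ext_penult /last_asc /turn /=.
have := absz_entry_bounds s (i := m.+1); rewrite leqnn => /(_ isT) bd.
have adj := entry_adj_neq s (ltnSn m).
rewrite -[if _ then _ else _](_ : pvar ^+ ((entry s m < entry s m.+1) && b)
    * qvar ^+ ((entry s m.+1 < entry s m) && ~~ b) = _); last first.
  by case: ltgtP adj => // _ _; rewrite expr0 ?mulr1 ?mul1r.
by congr (_ ^+ nat_of_bool _ * _ ^+ nat_of_bool _); case: b;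
  rewrite ?expr0 ?expr1; lia.
Qed.

Lemma append_sumS m b :
  append_sum m.+1 b = pvar ^+ b * SgnBAltrun_a m.+1
                    + qvar ^+ (~~ b) * SgnBAltrun_d m.+1.
Proof.
rewrite /append_sum (bigID (@last_asc m.+1)) /= SgnBAltrun_aE SgnBAltrun_dE //.
rewrite !mulr_sumr; congr (_ + _); apply: eq_bigr => s s_asc;
  rewrite turns_append ?s_asc ?(negbTE s_asc) /term; ring.
Qed.

(** With A and D the two sums for m+1, this is (A + qD) - q(pA + D): the terms in D cancel. For the
    descents, the terms in A cancel likewise. *)
Lemma SgnBAltrun_a_rec m :
  SgnBAltrun_a m.+3 = (1 - pvar * qvar) * SgnBAltrun_a m.+1.
Proof. rewrite SgnBAltrun_a_append !append_sumS /= !expr0 !expr1; ring. Qed.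

Lemma SgnBAltrun_d_rec m :
  SgnBAltrun_d m.+3 = (1 - pvar * qvar) * SgnBAltrun_d m.+1.
Proof. rewrite SgnBAltrun_d_append !append_sumS /= !expr0 !expr1; ring. Qed.

(** * Initial values and closed forms *)

(** The even case starts here: B_0 has one element, and its last comparison is meaningless, so the
    values at n = 2 come from [append_sum] rather than from the recursion. *)
Lemma append_sum0 b : append_sum 0 b = 1.
Proof.
have [|s _] := @window_exist 0 [ffun i => (false, i)]; first by case.
rewrite /append_sum (big_pred1 s) => [|t].
  by rewrite /sign /turns !big_geq // mulr1.
by apply/esym/eqP/val_inj/ffunP; case.
Qed.

Lemma window1_inj : injective (fun pi : signed_perm 1 => (window pi ord0).1).
Proof.
move=> s t st; apply/val_inj/ffunP=> i; rewrite (ord1 i) /=.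
case: (window s ord0) (window t ord0) st => [b k] [b' k'] /= ->.
by rewrite (ord1 k) (ord1 k').
Qed.

Lemma last_asc1 (pi : signed_perm 1) : last_asc pi = ~~ (window pi ord0).1.
Proof. by rewrite /last_asc entry0 (entryS pi ord0) letter_val_gt0. Qed.

(** A single letter has no turn, and it is negative exactly when it descends from the entry 0. *)
Lemma term1 (pi : signed_perm 1) : term pi = (-1) ^+ ~~ last_asc pi.
Proof.
rewrite /term /turns big_geq // mulr1 /sign big_nat1 big_geq // mulr1.
rewrite /last_asc entry0 -leNgt le_eqVlt.
by have := entry_adj_neq pi (ltn0Sn 0); rewrite eq_sym entry0 => /negbTE->.
Qed.

Lemma signed_perm1_exist b : exists pi : signed_perm 1, (window pi ord0).1 = b.
Proof.
have [|s s_w] := @window_exist 1 [ffun i => (b, i)].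
  by move=> i j; rewrite (ord1 i) (ord1 j).
by exists s; rewrite s_w ffunE.
Qed.

Lemma SgnBAltrun_a1 : SgnBAltrun_a 1 = 1.
Proof.
have [s s_b] := signed_perm1_exist false.
rewrite SgnBAltrun_aE (big_pred1 s) => [|t].
  by rewrite term1 last_asc1 s_b.
by rewrite last_asc1 /= -(inj_eq window1_inj) s_b; case: (window t _).1.
Qed.

Lemma SgnBAltrun_d1 : SgnBAltrun_d 1 = - 1.
Proof.
have [s s_b] := signed_perm1_exist true.
rewrite SgnBAltrun_dE // (big_pred1 s) => [|t].
  by rewrite term1 last_asc1 s_b expr1.
by rewrite last_asc1 /= -(inj_eq window1_inj) s_b; case: (window t _).1.
Qed.

Lemma SgnBAltrun_even k :
  SgnBAltrun_a (2 * k.+1) = (1 - qvar) * (1 - pvar * qvar) ^+ k /\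
  SgnBAltrun_d (2 * k.+1) = (1 - pvar) * (1 - pvar * qvar) ^+ k.
Proof.
elim: k => [|k [IHa IHd]].
  by rewrite SgnBAltrun_a_append SgnBAltrun_d_append !append_sum0 !mulr1.
have -> : (2 * k.+2 = (2 * k).+1.+3)%N by lia.
have e2 : (2 * k.+1 = (2 * k).+2)%N by lia.
by rewrite SgnBAltrun_a_rec SgnBAltrun_d_rec -e2 IHa IHd exprS; split; ring.
Qed.

Lemma SgnBAltrun_odd k :
  SgnBAltrun_a (2 * k).+1 = (1 - pvar * qvar) ^+ k /\
  SgnBAltrun_d (2 * k).+1 = - (1 - pvar * qvar) ^+ k.
Proof.
elim: k => [|k [IHa IHd]].
  by rewrite muln0 SgnBAltrun_a1 SgnBAltrun_d1 expr0.
rewrite mulnS SgnBAltrun_a_rec SgnBAltrun_d_rec IHa IHd exprS.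
by split; ring.
Qed.

(** The recursion is stated for n > 2: [B_a 0] and [B_d 0] are empty, while the sums at n = 2 are
    1-q and 1-p. *)
Theorem theorem35 (n : nat) (hn : (2 <= n)%N) :
  ((2 < n)%N ->
     SgnBAltrun_a n = (1 - pvar * qvar) * SgnBAltrun_a (n - 2)%N /\
     SgnBAltrun_d n = (1 - pvar * qvar) * SgnBAltrun_d (n - 2)%N) /\
  (forall k : nat, n = (2 * k)%N ->
     [/\ SgnBAltrun_a n = (1 - qvar) * (1 - pvar * qvar) ^+ (k - 1)%N,
         SgnBAltrun_d n = (1 - pvar) * (1 - pvar * qvar) ^+ (k - 1)%N
       & SgnBAltrun n = (2 - pvar - qvar) * (1 - pvar * qvar) ^+ (k - 1)%N]) /\
  (forall k : nat, n = (2 * k + 1)%N ->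
     [/\ SgnBAltrun_a n = (1 - pvar * qvar) ^+ k,
         SgnBAltrun_d n = - (1 - pvar * qvar) ^+ k
       & SgnBAltrun n = 0]).
Proof.
split; last split.
- case: n hn => [|[|[|m]]] // _ _; rewrite -[m.+3]addn2 addnK addn2.
  by split; [apply: SgnBAltrun_a_rec | apply: SgnBAltrun_d_rec].
- case=> [|k] n_k; first by rewrite n_k in hn.
  rewrite subn1 /= SgnBAltrun_split; last exact: ltnW.
  have [n_a n_d] := SgnBAltrun_even k; rewrite -n_k in n_a n_d.
  by rewrite n_a n_d; split=> //; ring.
- move=> k; rewrite addn1 => n_k.
  rewrite SgnBAltrun_split; last exact: ltnW.
  have [n_a n_d] := SgnBAltrun_odd k; rewrite -n_k in n_a n_d.
  by rewrite n_a n_d subrr.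
Qed.
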